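(* For every odd prime $p$, the quantity $r_3((\mathbb{Z}/p\mathbb{Z})^n)^{1/n}$ is bounded away from $p$ as $n$ grows; that is, there exist a real number $c < p$ (depending only on $p$) and an integer $n_0$ such that $r_3((\mathbb{Z}/p\mathbb{Z})^n)^{1/n} \leq c$ for all integers $n \geq n_0$.
   Context: For a finite abelian group $G$, $r_3(G)$ denotes the maximal size of a subset of $G$ containing no three-term arithmetic progression. A three-term arithmetic progression means a nontrivial one: elements $a,\ a+h,\ a+2h$ of $G$ with $h \neq 0$. *)

(* Defs.v *)
From HB Require Import structures.
From mathcomp Require Import all_boot all_order all_algebra.

Set Implicit Arguments.
Unset Strict Implicit.
Unset Printing Implicit Defensive.

Import GRing.Theory.
Local Open Scope ring_scope.

(* Nontrivial only means h != 0: in a group with 2-torsion, a + h *+ 2 may equal a. *)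
Definition ap3_free (G : finZmodType) (A : {set G}) : bool :=
  [forall a : G, forall h : G,
    (h != 0) ==> ~~ [&& a \in A, a + h \in A & a + h *+ 2 \in A]].

Definition r3 (G : finZmodType) : nat :=
  \max_(A : {set G} | ap3_free A) #|A|.

(* Main.v *)
Require Import Defs.
From mathcomp Require Import all_boot all_order all_algebra.
From mathcomp Require Import reals exp.
From mathcomp Require Import finfield ring lra zify.

Set Implicit Arguments.
Unset Strict Implicit.
Unset Printing Implicit Defensive.

Import Order.TTheory GRing.Theory Num.Theory.
Local Open Scope ring_scope.

(** Slice rank argument of Croot-Lev-Pach, Ellenberg-Gijswijt and Tao.  On a
    progression-free set the tensor [x - 2 y + z = 0] is the diagonal tensor, of
    slice rank [#|A|].  It is also the polynomial
    [\prod_i (1 - (x_i - 2 y_i + z_i) ^ (p - 1))], of total degree [(p - 1) n], so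
    each of its monomials has degree at most [(p - 1) n / 3] in one of [x], [y],
    [z]; hence [#|A|] is at most 3 times the number of low-degree monomials.  A
    Chernoff bound shows that this number is at most [q ^ n] for some [q < p]. *)

(** * Slice rank of the diagonal tensor *)

Lemma kernel_vector_const1_on (F : fieldType) (N m : nat) (A : 'M[F]_(N, m)) :
  exists r (g : 'I_r -> 'I_N) (h : 'rV[F]_N),
    [/\ (N <= m + r)%N, injective g, h *m A = 0 & forall i, h 0 (g i) = 1].
Proof.
(* The left kernel of [A] has dimension at least [N - m]. Its basis [B] has an invertible minor of
   full size, on the columns picked by [g]; inverting that minor gives the combination of basis
   vectors that equals 1 on all these columns. *)
pose B := row_base (kermx A).
have Bfull : row_full B^T by rewrite /row_full mxrank_tr; exact: row_base_free.
pose g := fullrankfun Bfull.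
pose v := invmx (rowsub g B^T) *m (const_mx 1 : 'cV_(\rank (kermx A))).
exists (\rank (kermx A)), g, (v^T *m B); split.
- by rewrite mxrank_ker -leq_subLR leq_sub2l // rank_leq_col.
- exact: fullrankfun_inj.
- rewrite -mulmxA (_ : B *m A = 0) ?mulmx0 //.
  by apply/sub_kermxP; rewrite eq_row_base.
- move=> i.
  have e : rowsub g B^T *m v = const_mx 1.
    by rewrite mulKVmx // fullrowsub_unit.
  have := congr1 (fun M : 'cV_ _ => M i 0) e.
  rewrite [RHS]mxE => <-; rewrite !mxE.
  by apply: eq_bigr => j _; rewrite !mxE mulrC.
Qed.

(* Contracting the [x] variable against a vector that kills the [f1] slices and
   equals 1 on many coordinates leaves a large identity matrix, whose rank is at
   most the number of remaining slices. *)
Lemma slice_rank_diag (F : fieldType) (N : nat) (J : finType)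
    (S1 S2 S3 : {pred J}) (f1 f2 f3 : J -> 'I_N -> F)
    (g1 g2 g3 : J -> 'I_N -> 'I_N -> F) :
  (forall x y z, \sum_(a in S1) f1 a x * g1 a y z
     + \sum_(a in S2) f2 a y * g2 a x z
     + \sum_(a in S3) f3 a z * g3 a x y = ((x == y) && (y == z))%:R) ->
  (N <= #|S1| + (#|S2| + #|S3|))%N.
Proof.
move=> diag.
have [r [g [h [leN g_inj h0 h1]]]] :=
  kernel_vector_const1_on (\matrix_(x < N, i < #|S1|) f1 (enum_val i) x).
apply: leq_trans leN _; rewrite leq_add2l.
pose P2 := \matrix_(i < r, a < #|S2|) f2 (enum_val a) (g i).
pose Q2 := \matrix_(a < #|S2|, j < r) \sum_x h 0 x * g2 (enum_val a) x (g j).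
pose P3 := \matrix_(i < r, a < #|S3|) \sum_x h 0 x * g3 (enum_val a) x (g i).
pose Q3 := \matrix_(a < #|S3|, j < r) f3 (enum_val a) (g j).
have e : 1%:M = P2 *m Q2 + P3 *m Q3 :> 'M_r.
  apply/matrixP=> i j.
  have : \sum_x h 0 x * ((x == g i) && (g i == g j))%:R = (i == j)%:R.
    rewrite (bigD1 (g i)) //= eqxx h1 mul1r (inj_eq g_inj) big1 ?addr0 // => x.
    by move=> /negbTE->; rewrite mulr0.
  move=> eij; rewrite [LHS]mxE -eij.
  under eq_bigr => x _ do rewrite -diag !mulrDr.
  rewrite !big_split /= [X in X + _ + _](_ : _ = 0) ?add0r; last first.
    under eq_bigr do rewrite mulr_sumr.
    rewrite exchange_big big1 //= => a aS.
    have := congr1 (fun M : 'rV__ => M 0 (enum_rank_in aS a)) h0.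
    rewrite !mxE => h0a; under eq_bigr do rewrite mulrA.
    rewrite -mulr_suml [X in X * _](_ : _ = 0) ?mul0r // -[RHS]h0a.
    by apply: eq_bigr => x _; rewrite mxE enum_rankK_in.
  rewrite !mxE; congr (_ + _).
    under eq_bigr do rewrite mulr_sumr.
    rewrite exchange_big big_enum_val /=; apply: eq_bigr => a _.
    rewrite !mxE mulr_sumr; apply: eq_bigr => x _; exact: mulrCA.
  under eq_bigr do rewrite mulr_sumr.
  rewrite exchange_big big_enum_val /=; apply: eq_bigr => a _.
  rewrite !mxE mulr_suml; apply: eq_bigr => x _.
  by rewrite mulrA mulrAC.
rewrite -[leqLHS](mxrank1 F) e (leq_trans (mxrank_add _ _)) //.
by rewrite leq_add // mulmx_max_rank.
Qed.

(** The binomial theorem, applied twice: [w] is split off first, then [v], and the total degree [k]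
    forces the exponent of [u]. All exponents live in ['I_k.+1], the entry type of the exponent
    vectors used below. *)
Lemma trinomial (R : comPzRingType) (u v w : R) (k : nat) :
  (u + v + w) ^+ k =
  \sum_(t : 'I_k.+1 * 'I_k.+1 * 'I_k.+1 | (t.1.1 + t.1.2 + t.2 == k)%N)
     ('C(k - t.2, t.1.2) * 'C(k, t.2))%:R * (u ^+ t.1.1 * v ^+ t.1.2 * w ^+ t.2).
Proof.
rewrite exprDn [RHS]big_mkcond /=.
rewrite -(pair_bigA _ (fun (ab : 'I_k.+1 * 'I_k.+1) (c : 'I_k.+1) => if (ab.1 + ab.2 + c == k)%N then
   ('C(k - c, ab.2) * 'C(k, c))%:R * (u ^+ ab.1 * v ^+ ab.2 * w ^+ c) else 0)) /=.
rewrite exchange_big /=; apply: eq_bigr => c _.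
rewrite -(pair_bigA _ (fun (a b : 'I_k.+1) => if (a + b + c == k)%N then
   ('C(k - c, b) * 'C(k, c))%:R * (u ^+ a * v ^+ b * w ^+ c) else 0)) /=.
rewrite exchange_big /= exprDn mulr_suml -sumrMnl.
have ck : (c <= k)%N by rewrite -ltnS.
rewrite (big_ord_widen k.+1
  (fun b => u ^+ (k - c - b) * v ^+ b *+ 'C(k - c, b) * w ^+ c *+ 'C(k, c)))
  ?ltnS ?leq_subr //.
rewrite big_mkcond; apply: eq_bigr => b _; rewrite ltnS; case: ifP => hb.
  have ha : (k - c - b < k.+1)%N by rewrite ltnS -subnDA leq_subr.
  rewrite (bigD1 (Ordinal ha)) //= big1 ?addr0 => [|a].
    rewrite subnK // subnK // eqxx natrM -mulr_natr -[_ *+ 'C(k - c, b)]mulr_natr.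
    by rewrite mulrC -!mulrA; ring.
  rewrite -val_eqE /= => ane; case: ifP => // /eqP e.
  by lia.
by rewrite big1 // => a _; case: eqP => //; lia.
Qed.

(** Each term with nonzero coefficient goes to the first of its three factors whose index lies in
    [S]. Grouping terms by that shared factor produces at most [#|S|] slices in each of the three
    directions. *)
Lemma slice_rank_diag_sum (F : fieldType) (N : nat) (I J : finType)
    (S : {pred J}) (c : I -> F) (al be ga : I -> J) (f1 f2 f3 : J -> 'I_N -> F) :
  (forall i, c i != 0 -> [|| al i \in S, be i \in S | ga i \in S]) ->
  (forall x y z, \sum_i c i * (f1 (al i) x * f2 (be i) y * f3 (ga i) z)
     = ((x == y) && (y == z))%:R) ->
  (N <= 3 * #|S|)%N.
Proof.
move=> cS diag; rewrite !mulSn mul0n addn0.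
apply: (@slice_rank_diag F N J S S S f1 f2 f3
  (fun a y z => \sum_(i | (al i \in S) && (al i == a))
     c i * (f2 (be i) y * f3 (ga i) z))
  (fun b x z => \sum_(i | ((al i \notin S) && (be i \in S)) && (be i == b))
     c i * (f1 (al i) x * f3 (ga i) z))
  (fun d x y => \sum_(i | ((al i \notin S) && (be i \notin S) && (ga i \in S))
                          && (ga i == d))
     c i * (f1 (al i) x * f2 (be i) y))) => x y z.
rewrite -diag (bigID (fun i => al i \in S)) /= -addrA; congr (_ + _).
  rewrite (partition_big al (mem S)) //=; apply: eq_bigr => a _.
  by rewrite mulr_sumr; apply: eq_bigr => i /andP[_ /eqP<-]; ring.
rewrite (bigID (fun i => be i \in S)) /=; congr (_ + _).
  rewrite (partition_big be (mem S)) /= => [|i /andP[]//].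
  apply: eq_bigr => a _.
  by rewrite mulr_sumr; apply: eq_bigr => i /andP[_ /eqP<-]; ring.
rewrite (bigID (fun i => ga i \in S)) /= [X in _ + X]big1 ?addr0 => [|i].
  rewrite (partition_big ga (mem S)) /= => [|i /andP[]//].
  apply: eq_bigr => a _.
  by rewrite mulr_sumr; apply: eq_bigr => i /andP[_ /eqP<-]; ring.
move=> /andP[/andP[/negbTE ai /negbTE bi] /negbTE gi].
have [->|/cS] := eqVneq (c i) 0; first by rewrite mul0r.
by rewrite ai bi gi.
Qed.

(** * The progression tensor as a polynomial *)

Lemma one_sub_expf_pred_card (F : finFieldType) (u : F) :
  1 - u ^+ #|F|.-1 = (u == 0)%:R.
Proof.
have card_gt1 := finNzRing_gt1 F.
have [->|u0] := eqVneq u 0.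
  by rewrite expr0n -subn1 subn_eq0 leqNgt card_gt1 subr0.
apply/eqP; rewrite subr_eq0 eq_sym -(inj_eq (mulfI u0)) mulr1 -exprS.
by rewrite prednK ?expf_card // ltnW.
Qed.

(** This handles a single coordinate, by expanding [1 - (u + v + w) ^+ k]: the constant 1 sits at
    the zero exponents and every other contribution has degree exactly [k]. *)
Lemma indicator_add3_expansion (F : finFieldType) (k := #|F|.-1) :
  exists c : 'I_k.+1 * 'I_k.+1 * 'I_k.+1 -> F,
    (forall t, c t != 0 -> (t.1.1 + t.1.2 + t.2 <= k)%N) /\
    forall u v w, (u + v + w == 0)%:R =
      \sum_t c t * (u ^+ t.1.1 * v ^+ t.1.2 * w ^+ t.2).
Proof.
exists (fun t => (t == (ord0, ord0, ord0))%:R -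
  (if (t.1.1 + t.1.2 + t.2 == k)%N
   then ('C(k - t.2, t.1.2) * 'C(k, t.2))%:R else 0)); split=> [t|u v w].
  have [->|_] := eqVneq t; first by [].
  by case: ifP => [/eqP->//|_]; rewrite subr0 eqxx.
rewrite -one_sub_expf_pred_card trinomial; under [RHS]eq_bigr do rewrite mulrBl.
rewrite sumrB; congr (_ - _); last first.
  rewrite big_mkcond; apply: eq_bigr => t _.
  by case: ifP; rewrite // mul0r.
rewrite (bigD1 (ord0, ord0, ord0)) //= big1 ?addr0 ?expr0 ?eqxx ?mulr1 //.
by move=> t /negbTE->; rewrite mul0r.
Qed.

Definition low_degree (n k : nat) : {set {ffun 'I_n -> 'I_k.+1}} :=
  [set a : {ffun 'I_n -> 'I_k.+1} | (3 * \sum_i a i <= k * n)%N].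

Lemma sum3_leq_not_all_gt (m d1 d2 d3 : nat) :
  (d1 + d2 + d3 <= m)%N -> (m < 3 * d1)%N -> (m < 3 * d2)%N -> (m < 3 * d3)%N ->
  False.
Proof. lia. Qed.

Lemma ap3_free_card_le (F : finFieldType) (n : nat) (A : {set 'rV[F]_n}) :
  ap3_free A -> (#|A| <= 3 * #|low_degree n #|F|.-1|)%N.
Proof.
move=> freeA; set k := #|F|.-1.
have [c [c_deg cE]] := indicator_add3_expansion F.
pose mono (x : 'rV[F]_n) (a : {ffun 'I_n -> 'I_k.+1}) := \prod_i x 0 i ^+ a i.
pose T := ('I_k.+1 * 'I_k.+1 * 'I_k.+1)%type.
pose al (f : {ffun 'I_n -> T}) := [ffun i => (f i).1.1].
pose be (f : {ffun 'I_n -> T}) := [ffun i => (f i).1.2].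
pose ga (f : {ffun 'I_n -> T}) := [ffun i => (f i).2].
(* Multiplying out over the coordinates, a term is a function [f] choosing one monomial per
   coordinate. The factor -2 is absorbed into the point where the [y] monomial is evaluated. *)
apply: (@slice_rank_diag_sum F #|A| {ffun 'I_n -> T} _ _
  (fun f => \prod_i c (f i)) al be ga
  (fun a x => mono (enum_val x) a) (fun a y => mono (- (enum_val y *+ 2)) a)
  (fun a z => mono (enum_val z) a)) => [f|x y z].
  move=> /prodf_neq0 cf; rewrite !inE.
  have : (\sum_i al f i + \sum_i be f i + \sum_i ga f i <= k * n)%N.
    rewrite -!big_split /= mulnC -[X in (_ <= X * _)%N]card_ord -sum_nat_const.
    by apply: leq_sum => i _; rewrite !ffunE; apply/c_deg/cf.
  move=> h; apply/negPn/negP; rewrite !negb_or -!ltnNge => /and3P[].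
  exact: sum3_leq_not_all_gt h.
rewrite -!(inj_eq enum_val_inj); have xA := enum_valP x; have yA := enum_valP y.
have zA := enum_valP z; set X := enum_val x in xA *; set Y := enum_val y in yA *.
set Z := enum_val z in zA *.
transitivity (\prod_i (X 0 i + (- (Y *+ 2)) 0 i + Z 0 i == 0)%:R : F).
  under [RHS]eq_bigr do rewrite cE.
  rewrite bigA_distr_bigA /=; apply: eq_bigr => f _.
  by rewrite -!big_split; apply: eq_bigr => i _; rewrite !ffunE.
transitivity ((X - Y *+ 2 + Z == 0)%:R : F).
  case: eqP => [e0|ne].
    rewrite big1 // => i _; have := congr1 (fun M : 'rV_n => M 0 i) e0.
    by rewrite !mxE => ->; rewrite eqxx.
  apply/eqP/negPn/negP => /prodf_neq0 nz; apply: ne; apply/rowP => i.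
  have := nz i isT; case E: (_ + _ + _ == 0); last by rewrite eqxx.
  by move=> _; move/eqP: E; rewrite !mxE.
congr (nat_of_bool _)%:R.
apply/eqP/andP => [e0 | [/eqP-> /eqP->]]; last first.
  by rewrite mulr2n opprD addrA subrr sub0r addNr.
(* A zero of the tensor is a progression in [A] of step [Y - X], so freeness forces this step to
   vanish. *)
have eZ : X + (Y - X) *+ 2 = Z.
  apply/eqP; rewrite -subr_eq0 -oppr_eq0 -e0 mulrnBl !mulr2n.
  by apply/eqP/rowP => i; rewrite !mxE; ring.
have /forallP/(_ X)/forallP/(_ (Y - X)) := freeA.
rewrite [X + (Y - X)]addrC subrK eZ xA yA zA /= implybF negbK subr_eq0 => /eqP eYX.
by rewrite -eZ eYX subrr mul0rn addr0.
Qed.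

(** * Counting low-degree monomials *)

Lemma low_degree_card_le (R : numDomainType) (n k : nat) (s : R) :
  0 <= s <= 1 ->
  #|low_degree n k|%:R * (s ^+ k) ^+ n <= (\sum_(j < k.+1) s ^+ (3 * j)) ^+ n.
Proof.
move=> /andP[s0 s1].
(* The right side expands into the sum of [s ^+ (3 * \sum_i a i)] over all exponent vectors [a]. As
   [s <= 1], each low-degree one contributes at least [s ^+ (k * n)]. *)
rewrite -exprM -[X in _ <= _ ^+ X]card_ord -prodr_const bigA_distr_bigA /=.
rewrite (bigID (mem (low_degree n k))) /= -[leLHS]addr0 lerD //; last first.
  by apply: sumr_ge0 => a _; apply: prodr_ge0 => i _; rewrite exprn_ge0.
rewrite mulr_natl -sumr_const; apply: ler_sum => a; rewrite inE => low_a.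
rewrite prodrXr -big_distrr /=.
by apply: ler_wiXn2l.
Qed.

(* The difference of the two sides vanishes at [s = 1] and has positive
   derivative [k (k + 1) / 2] there; the weights are cubed so that the threshold
   [k n / 3] stays integral. *)
Lemma exists_small_weight (R : realFieldType) (k : nat) : (0 < k)%N ->
  exists2 s : R, 0 < s < 1 & \sum_(j < k.+1) s ^+ (3 * j) < k.+1%:R * s ^+ k.
Proof.
move=> k0.
pose Q : {poly R} := \sum_(j < k.+1) 'X^(3 * j) - k.+1%:R *: 'X^k.
have QE x : Q.[x] = \sum_(j < k.+1) x ^+ (3 * j) - k.+1%:R * x ^+ k.
  rewrite !hornerE horner_sum; congr (_ - _).
  by apply: eq_bigr => j _; rewrite !hornerE.
have /factor_theorem[T QT] : root Q 1.
  rewrite /root QE expr1n mulr1; under eq_bigr do rewrite expr1n.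
  by rewrite sumr_const card_ord subrr.
have T1 : 0 < T.[1].
  have -> : T.[1] = Q^`().[1].
    by rewrite QT derivM !hornerE derivXsubC !hornerE subrr mulr0 add0r.
  rewrite /Q derivB derivZ derivXn linear_sum !hornerE hornerMn hornerXn expr1n horner_sum.
  under eq_bigr do rewrite /= derivXn hornerMn hornerXn expr1n.
  rewrite -natr_sum -natrM subr_gt0 ltr_nat -big_distrr /=.
  rewrite -(big_mkord xpredT id) bin2_sum bin2 /=.
  have := odd_double_half (k.+1 * k); rewrite oddM /= andNb.
  have : (0 < k.+1 * k)%N by rewrite muln_gt0.
  by set m := (k.+1 * k)%N; lia.
(* A second division by ['X - 1] replaces a limit argument: [U] is at most [B] on the unit interval,
   so [T] at [1 - e] is at least [T.[1] - e * B], and [e] is chosen to keep this positive. *)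
have /factor_theorem[U TU] : root (T - T.[1]%:P) 1.
  by rewrite /root !hornerE subrr.
pose B := \sum_(i < size U) `|U`_i|.
have B0 : 0 <= B by apply: sumr_ge0.
have UB x : 0 <= x <= 1 -> U.[x] <= B.
  move=> /andP[x0 x1]; rewrite horner_coef; apply: ler_sum => i _.
  rewrite (le_trans (ler_norm _)) // normrM ler_piMr // ger0_norm ?exprn_ge0 //.
  exact: exprn_ile1.
pose e := T.[1] / (T.[1] + B + 1).
have d0 : 0 < T.[1] + B + 1 by lra.
have e0 : 0 < e by rewrite divr_gt0.
have e1 : e < 1 by rewrite ltr_pdivrMr //; lra.
have eB : e * B < T.[1].
  rewrite mulrAC ltr_pdivrMr // ltr_pM2l //; lra.
exists (1 - e); first by apply/andP; split; lra.
rewrite -subr_lt0 -QE QT.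
have TE : T.[1 - e] = T.[1] - e * U.[1 - e].
  have := congr1 (horner^~ (1 - e)) TU; rewrite !hornerE => h; lra.
rewrite !hornerE TE.
have /UB le_UB : 0 <= 1 - e <= 1 by apply/andP; split; lra.
have : e * U.[1 - e] <= e * B by rewrite ler_pM2l.
move=> ?; rewrite addrAC subrr sub0r mulrN oppr_lt0 mulr_gt0 //; lra.
Qed.

(** * Passing to the [n]-th root *)

Lemma bernoulli_ineq (R : numDomainType) (d : R) (n : nat) :
  0 <= d -> 1 + n%:R * d <= (1 + d) ^+ n.
Proof.
move=> d0; elim: n => [|n IHn]; first by rewrite mul0r addr0 expr0.
rewrite exprSr; apply: le_trans (ler_wpM2r _ IHn); last by rewrite addr_ge0.
rewrite -natr1 -subr_ge0.
have -> : (1 + n%:R * d) * (1 + d) - (1 + (n%:R + 1) * d) = n%:R * (d * d) by ring.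
by rewrite !mulr_ge0.
Qed.

(** This absorbs the factor 3 of the slice rank bound: by Bernoulli, [(c / q) ^+ n] grows at least
    linearly in [n]. *)
Lemma expr_ratio_absorbs (R : archiRealFieldType) (K q c : R) :
  0 <= K -> 0 < q < c -> exists n0, forall n, (n0 <= n)%N -> K * q ^+ n <= c ^+ n.
Proof.
move=> K0 /andP[q0 lt_qc]; pose d := c / q - 1.
have d0 : 0 < d by rewrite subr_gt0 ltr_pdivlMr // mul1r.
exists (Num.bound (K / d)) => n len.
have -> : c = (1 + d) * q by rewrite /d addrC subrK divfK ?gt_eqF.
rewrite exprMn ler_wpM2r ?exprn_ge0 ?(ltW q0) //.
apply: le_trans (bernoulli_ineq n (ltW d0)).
rewrite (le_trans (y := n%:R * d)) ?lerDr //.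
rewrite -ler_pdivrMr // (le_trans (y := (Num.bound (K / d))%:R)) ?ler_nat //.
by rewrite ltW // archi_boundP // divr_ge0 // ltW.
Qed.

Theorem mainTheorem2 (R : realType) (p : nat) (p_prime : prime p)
    (p_odd : odd p) :
  exists2 c : R, c < p%:R &
    exists n0 : nat, forall n : nat, (n0 <= n)%N ->
      (r3 'rV['F_p]_n)%:R `^ (n%:R^-1) <= c.
Proof.
pose k := p.-1.
have kp : k.+1 = p by rewrite prednK ?prime_gt0.
have k0 : (0 < k)%N by rewrite -ltnS kp prime_gt1.
have [s /andP[s0 s1] s_small] := exists_small_weight R k0.
pose q := (\sum_(j < k.+1) s ^+ (3 * j)) / s ^+ k.
have sk0 : 0 < s ^+ k by rewrite exprn_gt0.
have q0 : 0 < q.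
  rewrite divr_gt0 // big_ord_recl expr0 ltr_wpDr // sumr_ge0 // => j _.
  by rewrite exprn_ge0 // ltW.
have qp : q < p%:R by rewrite ltr_pdivrMr // -kp.
(* Any value strictly between [q] and [p] would do: above [q] to absorb the factor 3, below [p] for
   the conclusion. *)
pose c := (q + p%:R) / 2.
have qc : q < c by rewrite /c; lra.
have [n0 absorb] := @expr_ratio_absorbs R 3 q c (ler0n _ 3) (introT andP (conj q0 qc)).
exists c; first by rewrite /c; lra.
(* The successor makes [n] positive; at [n = 0] the exponent [n%:R^-1] would be 0 by convention and
   would not cancel against [n]. *)
exists n0.+1 => n lt_n0n.
have n_gt0 : (0 < n)%N by apply: leq_trans lt_n0n.
have r3_le : (r3 'rV['F_p]_n <= 3 * #|low_degree n k|)%N.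
  apply/bigmax_leqP => A freeA.
  by have := ap3_free_card_le freeA; rewrite card_Fp.
have r3_le_c : (r3 'rV['F_p]_n)%:R <= c ^+ n :> R.
  apply: le_trans (absorb n (ltnW lt_n0n)).
  rewrite (le_trans (y := (3 * #|low_degree n k|)%:R)) ?ler_nat //.
  rewrite natrM ler_pM2l // expr_div_n ler_pdivlMr ?exprn_gt0 //.
  by apply: low_degree_card_le; rewrite !ltW.
have c0 : 0 <= c by rewrite ltW // (lt_trans q0).
rewrite (le_trans (y := (c ^+ n) `^ n%:R^-1)) //.
  by apply: ge0_ler_powR; rewrite ?nnegrE ?invr_ge0 ?exprn_ge0 ?ler0n.
by rewrite -powR_mulrn // -powRrM mulfV ?powRr1 // pnatr_eq0 -lt0n.
Qed.
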